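(* Let $n \geq 1$ be an integer and let $F(x,y) \in \mathbb{C}[x,y]$ be a (nonzero) binary form of degree $n$ with complex coefficients, having exactly $r$ roots on the real projective line $\mathbb{R}\mathbb{P}^1$, counting multiplicity. Let $h_F$ denote the height of $F$ and let $A_F$ denote the area of its fundamental region. Then $$h_F^{2/n} A_F \geq \left(2^{1 + (r/n)}\right)\pi.$$
   Context: A binary form of degree $n$ with complex coefficients is a homogeneous polynomial of degree $n$ in $\mathbb{C}[x,y]$. Write it as a product of $n$ linear forms in $\mathbb{C}[x,y]$, $$F(x,y) = \prod_{k=0}^{n-1} (\delta_k x - \gamma_k y), \qquad \gamma_k, \delta_k \in \mathbb{C}.$$ The roots of $F$ are the points $(\gamma_k : \delta_k)$ of the complex projective line. A root lies on $\mathbb{R}\mathbb{P}^1$ if it can be represented by real homogeneous coordinates; roots are counted with multiplicity, so $0 \le r \le n$. The height of $F$ is $$h_F = \prod_{k=0}^{n-1} \sqrt{|\gamma_k|^2 + |\delta_k|^2},$$ which does not depend on the chosen factorization. The fundamental region of $F$ is $$\mathcal{D}_F = \{(x,y) \in \mathbb{R}^2 : |F(x,y)| \leq 1\},$$ and $A_F \in (0, \infty]$ is its area (two-dimensional Lebesgue measure). The area may be infinite, in which case $h_F^{2/n}A_F$ is understood to be $\infty$. *)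

(* Defs.v *)
From mathcomp Require Import all_boot all_order all_algebra.
From mathcomp Require Import complex.
From mathcomp Require Import -(notations) mpoly.
From mathcomp Require Import all_classical all_reals all_analysis.

Set Implicit Arguments.
Unset Strict Implicit.
Unset Printing Implicit Defensive.

Import Order.TTheory GRing.Theory Num.Theory.
Import numFieldNormedType.Exports.

Local Open Scope classical_set_scope.
Local Open Scope ring_scope.
Local Open Scope complex_scope.

(* R-valued modulus of a complex number; [`|z|] lives in R[i] instead. *)
Notation normc := ComplexField.Normc.normc.

(* The notations of mpoly clash with those of MathComp-Analysis, hence the bare
   constants: [mpoly 2 C] is C[x, y], with x and y the variables of index 0
   and 1. *)

Definition binary_form (R : realType) (n : nat) (F : mpoly 2%N R[i]) : bool :=
  F \is ishomog1 n mdeg.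

(* The linear form [delta x - gamma y], given as the pair (gamma, delta). *)
Definition linear_form (R : realType) (p : R[i] * R[i]) : mpoly 2%N R[i] :=
  p.2 *: mpolyX R[i] (mnm1 (0 : 'I_2)) - p.1 *: mpolyX R[i] (mnm1 (1 : 'I_2)).

Definition is_factorization (R : realType) (n : nat) (F : mpoly 2%N R[i])
    (p : {ffun 'I_n -> R[i] * R[i]}) : Prop :=
  F = \prod_(k < n) linear_form (p k).

(* The default value is never used on a binary form of degree n >= 1, and the
   choice is immaterial below: see [factorization_exists], [heightE] and
   [num_real_rootsE]. *)
Definition factorization (R : realType) (n : nat) (F : mpoly 2%N R[i]) :
    {ffun 'I_n -> R[i] * R[i]} :=
  xget [ffun=> (0, 0)] [set p | is_factorization F p].

Definition on_RP1 (R : realType) (p : R[i] * R[i]) : Prop :=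
  exists (c : R[i]) (a b : R),
    [/\ c != 0, (a, b) != (0, 0) & p = (c * a%:C, c * b%:C)].

Definition num_real_roots (R : realType) (n : nat) (F : mpoly 2%N R[i]) : nat :=
  #|[pred k : 'I_n | `[< on_RP1 (factorization n F k) >]]|.

Definition height (R : realType) (n : nat) (F : mpoly 2%N R[i]) : R :=
  \prod_(k < n) Num.sqrt (normc (factorization n F k).1 ^+ 2
                          + normc (factorization n F k).2 ^+ 2).

Definition form_eval (R : realType) (F : mpoly 2%N R[i]) (z : R * R) : R[i] :=
  meval (fun i : 'I_2 => if i == 0 then z.1%:C else z.2%:C) F.

Definition fundamental_region (R : realType) (F : mpoly 2%N R[i]) :
    set (R * R) :=
  [set z | normc (form_eval F z) <= 1].

Definition area (R : realType) (A : set (R * R)) : \bar R :=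
  (lebesgue_measure \x lebesgue_measure)%E A.

Section factorization_exists.
Variable R : realType.
Implicit Types (p q : {poly R[i]}) (F : mpoly 2%N R[i]).

Local Notation X := (mpolyX R[i] (mnm1 (0 : 'I_2))).
Local Notation Y := (mpolyX R[i] (mnm1 (1 : 'I_2))).

Let hom (m : nat) p : mpoly 2%N R[i] :=
  \sum_(i < m.+1) p`_i *: (X ^+ i * Y ^+ (m - i)).

Let homD m p q : hom m (p + q) = hom m p + hom m q.
Proof.
by rewrite /hom -big_split; apply: eq_bigr => i _; rewrite coefD scalerDl.
Qed.

Let homZ m c p : hom m (c *: p) = c *: hom m p.
Proof.
by rewrite /hom scaler_sumr; apply: eq_bigr => i _; rewrite coefZ scalerA.
Qed.

Let homY m p : (size p <= m.+1)%N -> hom m.+1 p = Y * hom m p.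
Proof.
move=> sp; rewrite /hom big_ord_recr /= nth_default // scale0r addr0.
rewrite mulr_sumr; apply: eq_bigr => i _.
by rewrite subSn -1?ltnS // exprS -scalerAr mulrCA.
Qed.

Let homX m p : hom m.+1 (p * 'X) = X * hom m p.
Proof.
rewrite /hom big_ord_recl coefMX eqxx scale0r add0r mulr_sumr.
apply: eq_bigr => i _; rewrite coefMX /= /bump /= add1n subSS exprS.
by rewrite -scalerAr mulrA.
Qed.

Let hom_factor m p : (size p <= m.+2)%N ->
  exists c q, (size q <= m.+1)%N /\ hom m.+1 p = linear_form c * hom m q.
Proof.
move=> sp; have [sp1|sp1] := leqP (size p) m.+1.
  exists (-1, 0), p; split=> //.
  by rewrite homY // /linear_form /= scale0r scaleN1r opprK add0r.
have p1 : size p != 1%N by rewrite gtn_eqF // (leq_trans _ sp1).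
have [z /factor_theorem[q pE]] := closed_rootP p p1.
have p0 : p != 0 by rewrite -size_poly_gt0 (leq_trans _ sp1).
exists (z, 1), q; have sq : (size q <= m.+1)%N.
  have q0 : q != 0 by apply: contraNneq p0 => q0; rewrite pE q0 mul0r.
  by move: sp; rewrite pE size_Mmonic ?monicXsubC // size_XsubC addn2.
split=> //; rewrite pE mulrBr mulrC mulrC homD -scaleN1r homZ homX.
rewrite [_ * z%:P]mulrC mul_polyC homZ homY // /linear_form /= scale1r mulrBl.
by rewrite scaleN1r -scalerAl.
Qed.

Let hom_fact m p : (size p <= m.+2)%N ->
  exists g : {ffun 'I_m.+1 -> R[i] * R[i]}, is_factorization (hom m.+1 p) g.
Proof.
elim: m p => [|m IH] p /[dup] sp /hom_factor[c [q [sq ->]]].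
  pose d : R[i] * R[i] := (q`_0 * c.1, q`_0 * c.2).
  exists [ffun=> d].
  rewrite /is_factorization big_ord1 ffunE {}/d /hom big_ord1 /linear_form /=.
  by rewrite !expr0 mulr1 mulrC -scalerAl mul1r scalerBr !scalerA.
have [g ->] := IH _ sq.
exists [ffun k => if unlift ord0 k is Some j then g j else c].
rewrite /is_factorization [RHS]big_ord_recl ffunE unlift_none; congr (_ * _).
by apply: eq_bigr => i _; rewrite ffunE liftK.
Qed.

Lemma factorization_exists (n : nat) F : (0 < n)%N -> binary_form n F ->
  exists g : {ffun 'I_n -> R[i] * R[i]}, is_factorization F g.
Proof.
case: n => // n _ /dhomogP Fn.
pose mon (i : nat) := mnm_add (mnm_muln (mnm1 (0 : 'I_2)) i)
                              (mnm_muln (mnm1 (1 : 'I_2)) (n.+1 - i)).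
suff -> : F = hom n.+1 (\poly_(i < n.+2) mcoeff (mon i) F).
  exact/hom_fact/size_poly.
have monE (i : nat) (j : 'I_2) : mon i j = if j == 0 then i else (n.+1 - i)%N.
  rewrite mnmDE !mulmnE !mnm1E.
  by case: j => -[|[]] //= ?; rewrite ?mul1n ?mul0n ?addn0.
apply/mpolyP => m; rewrite /hom raddf_sum /=.
under eq_bigr => i _.
  rewrite coef_poly ltn_ord mcoeffZ !mpolyXn -mpolyXD mcoeffX -/(mon i).
  over.
have [mF|mF] := boolP (m \in msupp F); last first.
  rewrite memN_msupp_eq0 // big1 // => i _; case: eqP => [->|_].
    by rewrite memN_msupp_eq0 // mul0r.
  by rewrite mulr0.
have mn : mdeg m = n.+1 := Fn _ mF.
rewrite mdegE !big_ord_recl big_ord0 addn0 in mn.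
have m0 : (m ord0 < n.+2)%N by rewrite ltnS -mn leq_addr.
have mE : mon (m ord0) = m.
  apply/mnmP => j; rewrite monE -mn addKn.
  by case: j => -[|[]] //= ?; congr (m _); apply: val_inj.
rewrite (bigD1 (Ordinal m0)) //= mE eqxx mulr1 big1 ?addr0 // => i /negP im.
case: eqP => [iE|_]; last by rewrite mulr0.
by case: im; rewrite -val_eqE /= -iE monE.
Qed.

End factorization_exists.

Section factorization_unique.
Variable R : realType.
Implicit Types (p : R[i] * R[i]) (s : seq (R[i] * R[i])) (F : mpoly 2%N R[i]).

Let ev p F : R[i] := meval (fun i : 'I_2 => if i == 0 then p.1 else p.2) F.

Let N p : R := Num.sqrt (normc p.1 ^+ 2 + normc p.2 ^+ 2).

Let evL p p' : ev p (linear_form p') = p'.2 * p.1 - p'.1 * p.2.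
Proof. by rewrite /ev /linear_form mevalB !mevalZ !mevalXU. Qed.

Let evLL p : ev p (linear_form p) = 0.
Proof. by rewrite evL mulrC subrr. Qed.

Let linear_form0 : linear_form (0, 0) = 0 :> mpoly 2%N R[i].
Proof. by rewrite /linear_form !scale0r subrr. Qed.

Let NZ (c : R[i]) p : N (c * p.1, c * p.2) = normc c * N p.
Proof.
have c0 : 0 <= normc c by case: c => a b; rewrite sqrtr_ge0.
rewrite /N /= !ComplexField.Normc.normcM !exprMn -mulrDr sqrtrM ?sqr_ge0 //.
by rewrite sqrtr_sqr ger0_norm.
Qed.

Let on_RP1Z (c : R[i]) p : c != 0 -> on_RP1 p -> on_RP1 (c * p.1, c * p.2).
Proof.
move=> c0 [d [a [b [d0 ab ->]]]]; exists (c * d), a, b; split=> //.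
  by rewrite mulf_neq0.
by rewrite /= !mulrA.
Qed.

Let proportional p p' : linear_form p != 0 -> linear_form p' != 0 ->
  ev p (linear_form p') = 0 ->
  exists2 c : R[i], c != 0 & p' = (c * p.1, c * p.2).
Proof.
move=> Lp Lp' /eqP; rewrite evL subr_eq0 => /eqP e.
have {}Lp : ~~ ((p.1 == 0) && (p.2 == 0)).
  by apply: contraNN Lp; case: p {e} => a b /= /andP[/eqP-> /eqP->];
     rewrite linear_form0.
suff [c cE] : exists c : R[i], p' = (c * p.1, c * p.2).
  exists c => //; apply: contraNneq Lp' => c0.
  by rewrite cE c0 !mul0r linear_form0.
have [p10|p10] := eqVneq p.1 0.
  have p20 : p.2 != 0 by move: Lp; rewrite p10 eqxx.
  exists (p'.2 / p.2); rewrite divfK // p10 mulr0; case: p' e {Lp'} => a b /= e.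
  by congr (_, _); apply: (mulIf p20); rewrite mul0r -e p10 mulr0.
exists (p'.1 / p.1); rewrite divfK // mulrAC -e mulfK //.
by case: p' {e Lp'}.
Qed.

Let uniq_seq s s' (a : R[i]) :
  \prod_(p <- s) linear_form p = a *: \prod_(p <- s') linear_form p ->
  \prod_(p <- s) linear_form p != 0 ->
  \prod_(p <- s) N p = normc a * \prod_(p <- s') N p /\
  count (fun p => `[< on_RP1 p >]) s = count (fun p => `[< on_RP1 p >]) s'.
Proof.
elim: s s' a => [|p s IH] s' a e n0.
  case: s' e => [|p' s'] e.
    move: e; rewrite !big_nil => /(congr1 (ev (0, 0))).
    by rewrite /ev mevalZ meval1 !mulr1 => <-; rewrite ComplexField.Normc.normc1.
  move: e; rewrite big_nil big_cons => /(congr1 (ev p')).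
  rewrite /ev mevalZ mevalM meval1 -/(ev _ _) evLL mul0r mulr0 => /eqP.
  by rewrite oner_eq0.
have a0 : a != 0 by apply: contraNneq n0 => a0; rewrite e a0 scale0r.
have n0' : \prod_(p <- s') linear_form p != 0.
  by apply: contraNneq n0 => s0; rewrite e s0 scaler0.
have Lp : linear_form p != 0.
  by apply: contraNneq n0 => Lp; rewrite big_cons Lp mul0r.
have [p' ps' ep'] : exists2 p', p' \in s' & ev p (linear_form p') = 0.
  have := congr1 (ev p) e; rewrite big_cons /ev mevalM mevalZ -!/(ev _ _) evLL.
  rewrite mul0r => /esym/eqP; rewrite mulf_eq0 (negbTE a0) /= {e n0'}.
  elim: s' => [|p' s' IHs'].
    by rewrite big_nil /ev meval1 oner_eq0.
  rewrite big_cons /ev mevalM -!/(ev _ _) mulf_eq0 => /orP[/eqP ep'|].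
    by exists p'; rewrite ?mem_head.
  by move=> /IHs'[q qs' eq0]; exists q => //; rewrite inE qs' orbT.
have pe := perm_to_rem ps'.
have Lp' : linear_form p' != 0.
  apply: contraNneq n0' => Lp'.
  by rewrite (perm_big _ pe) big_cons /= Lp' mul0r.
have [c c0 p'E] := proportional Lp Lp' ep'.
have LE : linear_form p' = c *: linear_form p.
  by rewrite p'E /linear_form scalerBr !scalerA.
have /IH[] : \prod_(p <- s) linear_form p =
             (a * c) *: \prod_(p <- rem p' s') linear_form p.
- have := e; rewrite big_cons (perm_big _ pe) big_cons /= LE.
  by rewrite -scalerAl scalerA scalerAr; exact: mulfI.
- by apply: contraNneq n0 => s0; rewrite big_cons s0 mulr0.
move=> eN eC; split.
  have Np' : N p' = normc c * N p by rewrite p'E NZ.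
  rewrite big_cons eN (perm_big _ pe) big_cons /= Np'.
  rewrite ComplexField.Normc.normcM !mulrA; congr (_ * _).
  by rewrite -mulrA mulrC.
have /permP -> := pe; rewrite /= eC; congr (_ + _)%N; congr nat_of_bool.
apply/asboolP/asboolP => [|h]; first by rewrite p'E; exact: on_RP1Z.
have := on_RP1Z (invr_neq0 c0) h.
by rewrite p'E /= !mulKf // -surjective_pairing.
Qed.

Let uniq_ffun n F (g h : {ffun 'I_n -> R[i] * R[i]}) : F != 0 ->
  is_factorization F g -> is_factorization F h ->
  \prod_k N (g k) = \prod_k N (h k) /\
  #|[pred k | `[< on_RP1 (g k) >]]| = #|[pred k | `[< on_RP1 (h k) >]]|.
Proof.
move=> F0 Fg Fh.
have toseq (T : Type) (idx : T) (op : T -> T -> T) (f : R[i] * R[i] -> T)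
    (u : {ffun 'I_n -> R[i] * R[i]}) :
    \big[op/idx]_k f (u k) = \big[op/idx]_(p <- map u (enum 'I_n)) f p.
  by rewrite big_map enumT.
have cnt (u : {ffun 'I_n -> R[i] * R[i]}) : #|[pred k | `[< on_RP1 (u k) >]]| =
    count (fun p => `[< on_RP1 p >]) (map u (enum 'I_n)).
  by rewrite count_map cardE enumT -size_filter.
have := @uniq_seq (map g (enum 'I_n)) (map h (enum 'I_n)) 1.
rewrite -!toseq -!cnt scale1r ComplexField.Normc.normc1 mul1r -Fg -Fh.
exact.
Qed.

Lemma heightE n F (g : {ffun 'I_n -> R[i] * R[i]}) : F != 0 ->
  is_factorization F g ->
  height n F = \prod_k Num.sqrt (normc (g k).1 ^+ 2 + normc (g k).2 ^+ 2).
Proof.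
by move=> F0 Fg; have [] := uniq_ffun F0 (xgetI [ffun=> (0, 0)] Fg) Fg.
Qed.

Lemma num_real_rootsE n F (g : {ffun 'I_n -> R[i] * R[i]}) : F != 0 ->
  is_factorization F g ->
  num_real_roots n F = #|[pred k | `[< on_RP1 (g k) >]]|.
Proof.
by move=> F0 Fg; have [] := uniq_ffun F0 (xgetI [ffun=> (0, 0)] Fg) Fg.
Qed.

End factorization_unique.

(* Main.v *)
Require Import Defs.
From mathcomp Require Import all_boot all_order all_algebra.
From mathcomp Require Import complex.
From mathcomp Require Import -(notations) mpoly.
From mathcomp Require Import all_classical all_reals all_analysis.
From mathcomp Require Import measurable_realfun.
From mathcomp Require Import ring lra.

(** The area is an average over directions, and the bound is Jensen's
inequality on the circle, made finite.

In polar coordinates the area of [{|F| <= 1}] is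
[1/2 \int |F(cos t, sin t)|^(-2/n) dt] over the circle.  By Jensen it is at
least [pi * exp (- (2/n) * mean of log |F(cos t, sin t)|)], and the mean of the
logarithm is additive over the linear factors of [F].  Writing
[delta cos t - gamma sin t = a e^(i t) + b e^(- i t)] with
[a, b = (delta +- i gamma) / 2], the mean of the logarithm of the modulus of
the factor is [log (max (|a|, |b|))].  Since
[|a|^2 + |b|^2 = (|gamma|^2 + |delta|^2) / 2], the square of this maximum is at
most half of [|gamma|^2 + |delta|^2], and it equals one quarter of it when
[|a| = |b|], that is, for a real root.  Every root thus contributes a factor
[2^(1/n)] to the bound, and every real root contributes it twice.

The logarithmic singularities at the real roots are avoided by replacing the
mean over the circle with the mean over the [N = 2^m] rotations of angles
[k pi / N].  These preserve the area ([area_rot], a rotation being a product of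
three shears), so that [N] times the area is the integral over [t = y / x] of
the sum of the [N] radial integrals ([area_polar], [radial_integral]), to which
the inequality between arithmetic and geometric means applies for each [t]
([agm_inv]).  The product that it involves splits over the linear factors of
[F], and is computed by the identity
[L(t) L(t + pi/2) = i (a^2 e^(2 i t) - b^2 e^(- 2 i t))]: the product of two
values of a linear form at orthogonal directions is the value of another linear
form at the doubled angle, whose coefficients are the squares of the former ones
up to a unit.  Iterating, the product of the [N] values is at most
[2 * max (|a|, |b|)^N] ([prod_lin_eval_le]).  What is left is the integral of
[1 / (1 + t^2)], which is [pi], times a factor that loses [2^(- 2 / N)], and
this loss disappears as [m] grows ([area_sublevel_ge]). *)

Set Implicit Arguments.
Unset Strict Implicit.
Unset Printing Implicit Defensive.

Import Order.TTheory GRing.Theory Num.Theory.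
Import numFieldNormedType.Exports.

Local Open Scope ring_scope.

(** * Area in the plane: rotations and polar coordinates *)

Section plane_area.
Context (R : realType).
Local Notation mu := (@lebesgue_measure R).
Local Notation mu2 := (mu \x mu)%E.
Local Open Scope classical_set_scope.
Local Open Scope ereal_scope.

Definition rot (c s : R) (z : R * R) : R * R :=
  (c * z.1 - s * z.2, s * z.1 + c * z.2)%R.

Lemma lebesgue_measure_affine (a b : R) (A : set R) :
  (a != 0)%R -> measurable A ->
  mu A = `|a|%:E * mu ((fun t => a * t + b)%R @^-1` A).
Proof.
move=> a0 mA.
have mf : measurable_fun setT (fun t : R => a * t + b : measurableTypeR R)%R.
  by apply: measurable_funD => //; exact: measurable_funM.
pose nu : {measure set (measurableTypeR R) -> \bar R} :=
  mscale (NngNum (normr_ge0 a)) (pushforward mu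
    (fun t : measurableTypeR R => a * t + b : measurableTypeR R)%R).
have -> : `|a|%:E * mu ((fun t => a * t + b)%R @^-1` A) = nu mf A by [].
apply: lebesgue_measure_unique => //= _ [[x y] /= _ <-].
rewrite /nu /mscale /=.
rewrite -[pushforward _ _ _]/(mu ((fun t : R => (a * t + b)%R) @^-1`
  `]x, y]%classic)).
have [a_gt0|a_lt0|] := ltgtP 0%R a; last first.
- by move=> /esym/eqP; rewrite (negbTE a0).
- rewrite (_ : (fun t : R => (a * t + b)%R) @^-1` _ =
      `[((y - b) / a)%R, ((x - b) / a)%R[%classic); last first.
    apply/seteqP; split => t /=; rewrite !in_itv /=;
    by rewrite ltr_ndivlMr// ler_ndivrMr// ltrBlDr lerBrDr ![(t * a)%R]mulrC
      andbC.
  rewrite !lebesgue_measure_itv /= !lte_fin ltr_nM2r ?invr_lt0// ltrD2r.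
  case: ifP => _; last by rewrite mule0.
  rewrite -!EFinD -EFinM ltr0_norm//; congr EFin; field; exact: a0.
- rewrite (_ : (fun t : R => (a * t + b)%R) @^-1` _ =
      `]((x - b) / a)%R, ((y - b) / a)%R]%classic); last first.
    apply/seteqP; split => t /=; rewrite !in_itv /=;
    by rewrite ltr_pdivrMr// ler_pdivlMr// ltrBlDr lerBrDr ![(t * a)%R]mulrC.
  rewrite !lebesgue_measure_itv /= !lte_fin ltr_pM2r ?invr_gt0// ltrD2r.
  case: ifP => _; last by rewrite mule0.
  rewrite -!EFinD -EFinM gtr0_norm//; congr EFin; field; exact: a0.
Qed.

Lemma measurable_linear_preimage (a b c d : R) (E : set (R * R)) :
  measurable E ->
  measurable ((fun z => (a * z.1 + b * z.2, c * z.1 + d * z.2)%R) @^-1` E).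
Proof.
move=> mE; rewrite -[X in measurable X]setTI.
apply: (_ : measurable_fun setT _) => //; apply/measurable_fun_pairP.
by split; apply: measurable_funD => //; exact: measurable_funM.
Qed.

Lemma measurable_shear1 k (E : set (R * R)) : measurable E ->
  measurable ((fun z => (z.1 + k * z.2, z.2)%R) @^-1` E).
Proof.
move=> /(measurable_linear_preimage 1 k 0 1).
by under eq_fun do rewrite !mul1r mul0r add0r.
Qed.

Lemma measurable_shear2 k (E : set (R * R)) : measurable E ->
  measurable ((fun z => (z.1, z.2 + k * z.1)%R) @^-1` E).
Proof.
move=> /(measurable_linear_preimage 1 0 k 1).
by under eq_fun do rewrite !mul1r mul0r addr0 [(k * _ + _)%R]addrC.
Qed.

Lemma measurable_rot (c s : R) (E : set (R * R)) : measurable E ->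
  measurable (rot c s @^-1` E).
Proof.
rewrite (_ : rot c s = fun z => (c * z.1 + - s * z.2, s * z.1 + c * z.2)%R).
  exact: measurable_linear_preimage.
by apply/funext => z; rewrite /rot mulNr.
Qed.

Lemma area_ysection (E : set (R * R)) : measurable E ->
  mu2 E = \int[mu]_y mu (ysection E y).
Proof.
move=> mE; rewrite -[RHS]/((mu \x^ mu) E).
by apply: product_measure_unique => //= A B mA mB; exact: product_measure2E.
Qed.

(** A shear along the first axis translates each horizontal section. *)
Lemma area_shear1 (k : R) (E : set (R * R)) : measurable E ->
  mu2 ((fun z => (z.1 + k * z.2, z.2)%R) @^-1` E) = mu2 E.
Proof.
move=> mE; rewrite !area_ysection//; last exact: measurable_shear1.
apply: eq_integral => y _ /=.
rewrite (@lebesgue_measure_affine 1 (k * y) (ysection E y)) ?oner_eq0//.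
  rewrite normr1 mul1e; congr (mu _); apply/seteqP.
  by split => x /=; rewrite /ysection /= !inE /= mul1r.
exact: measurable_ysection.
Qed.

Lemma area_shear2 (k : R) (E : set (R * R)) : measurable E ->
  mu2 ((fun z => (z.1, z.2 + k * z.1)%R) @^-1` E) = mu2 E.
Proof.
move=> mE; apply: eq_integral => x _ /=.
rewrite (@lebesgue_measure_affine 1 (k * x) (xsection E x)) ?oner_eq0//.
  rewrite normr1 mul1e; congr (mu _); apply/seteqP.
  by split => y /=; rewrite /xsection /= !inE /= mul1r.
exact: measurable_xsection.
Qed.

(** A rotation of angle [a != pi] is the product of three shears, of ratios
[- tan (a/2)], [sin a] and [- tan (a/2)]; algebraically,
[tan (a/2) = s / (1 + c)]. *)
Lemma area_rot (c s : R) (E : set (R * R)) :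
  (c ^+ 2 + s ^+ 2 = 1)%R -> (c != -1)%R -> measurable E ->
  mu2 (rot c s @^-1` E) = mu2 E.
Proof.
move=> cs c1 mE; pose u := (- s / (1 + c))%R.
have c1' : (1 + c != 0)%R by rewrite addrC addr_eq0.
have uE : (u * s = c - 1)%R.
  apply: (mulIf c1'); rewrite /u mulrAC divfK//.
  by rewrite mulNr -expr2 -(addKr (c ^+ 2) (s ^+ 2))%R cs; ring.
have ucE : (u + u * c = - s)%R by rewrite -[X in (X + _)%R]mulr1 -mulrDr divfK.
rewrite -(area_shear1 u mE) -[RHS](area_shear2 s); last exact: measurable_shear1.
rewrite -[RHS](area_shear1 u); last first.
  by apply: measurable_shear2; exact: measurable_shear1.
congr (mu2 _); apply: (congr1 (preimage^~ E)); apply/funext => -[x y].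
rewrite /rot /=; congr (_, _).
  have -> : (x + u * y + u * (y + s * (x + u * y)) =
             (1 + u * s) * x + (u + u * (1 + u * s)) * y)%R by ring.
  have e : (1 + u * s = c)%R by rewrite uE; ring.
  by rewrite e ucE mulNr.
have -> : (y + s * (x + u * y) = s * x + (1 + u * s) * y)%R by ring.
by rewrite uE; congr (_ + _ * _)%R; ring.
Qed.

Lemma measurable_polar (E : set (R * R)) : measurable E ->
  measurable_fun setT (fun z : R * R => (`|z.1| * \1_E (z.1, z.1 * z.2)%R)%:E).
Proof.
move=> mE; apply/measurable_EFinP; apply: measurable_funM.
  apply: measurableT_comp; last exact: measurable_fst.
  exact: normr_measurable.
have -> : (fun z : R * R => \1_E (z.1, z.1 * z.2) : R)%R =
    \1_((fun z : R * R => (z.1, z.1 * z.2)%R) @^-1` E).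
  by apply/funext => z; rewrite !indicE; congr (nat_of_bool _)%:R.
apply: measurable_indic; rewrite -[X in measurable X]setTI.
apply: (_ : measurable_fun setT _) => //; apply/measurable_fun_pairP.
by split; [exact: measurable_fst|exact: measurable_funM].
Qed.

Lemma measurable_radial_integral (E : set (R * R)) : measurable E ->
  measurable_fun setT
    (fun t : R => \int[mu]_x (`|x| * \1_E (x, x * t)%R)%:E).
Proof.
move=> mE; have f0 z : 0 <= (`|z.1| * \1_E (z.1, z.1 * z.2)%R)%:E.
  by rewrite lee_fin mulr_ge0.
exact: (@measurable_fun_fubini_tonelli_G _ _ _ _ R mu _ (measurable_polar mE) f0).
Qed.

(** Polar coordinates with the slope [t = y / x] as the angular parameter: each
vertical section is rescaled by [y = x * t], off the null line [x = 0]. *)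
Lemma area_polar (E : set (R * R)) : measurable E ->
  mu2 E = \int[mu]_t \int[mu]_x (`|x| * \1_E (x, x * t)%R)%:E.
Proof.
move=> mE; have mf := measurable_polar mE.
have f0 z : 0 <= (`|z.1| * \1_E (z.1, z.1 * z.2)%R)%:E.
  by rewrite lee_fin mulr_ge0.
rewrite -[RHS](@fubini_tonelli _ _ _ _ R mu mu _ mf f0) /=.
have mD : measurable ([set: measurableTypeR R] `\ 0%R) by exact: measurableD.
have mF : measurable_fun setT (mu \o xsection E).
  exact: measurable_fun_xsection.
rewrite -[LHS](@integral_setD1 _ _ 0%R _ mD)//; last exact: measurable_funTS.
rewrite -[RHS](@integral_setD1 _ _ 0%R _ mD)//; last first.
  apply: measurable_funTS.
  exact: (@measurable_fun_fubini_tonelli_F _ _ _ _ R mu _ mf f0).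
apply: eq_integral => x /=; rewrite inE /= => -[_ /eqP x0].
rewrite (lebesgue_measure_affine 0 x0); last exact: measurable_xsection.
set S := _ @^-1` _.
have mS : measurable S.
  rewrite -[X in measurable X]setTI; apply: (_ : measurable_fun setT _) => //.
    by apply: measurable_funD => //; exact: measurable_funM.
  exact: measurable_xsection.
have SE y : (x, x * y)%R \in E = (y \in S).
  by apply/idP/idP; rewrite /S /xsection !inE /= !inE addr0.
transitivity (\int[mu]_y (`|x|%:E * (\1_S y)%:E)).
  rewrite ge0_integralZl_EFin// ?integral_indic ?setIT//.
  exact/measurable_EFinP/measurable_indic.
by apply: eq_integral => y _; rewrite EFinM !indicE SE.
Qed.

Lemma integral_linear (k a b : R) : (a < b)%R ->
  \int[mu]_(x in `[a, b]) (k * x)%:E = (k * (b ^+ 2 - a ^+ 2) / 2)%:E.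
Proof.
move=> ab.
have d (x : R) : is_derive x 1%R (fun t : R => k / 2 * t ^+ 2)%R (k * x)%R.
  by apply: is_derive_eq; rewrite /GRing.scale /=; field.
have c : continuous (fun t : R => k / 2 * t ^+ 2)%R.
  by move=> ?; apply: cvgMl_tmp; apply: exprn_continuous.
apply: (etrans (@continuous_FTC2 _ _ (fun t : R => k / 2 * t ^+ 2)%R
  _ _ ab _ _ _)).
- by apply: continuous_subspaceT => x; apply: cvgMl_tmp; exact: cvg_id.
- split; first by move=> x _; exact: ex_derive.
  + exact/cvg_at_right_filter/c.
  + exact/cvg_at_left_filter/c.
- by move=> x _; rewrite derive1E; exact: derive_val.
- by rewrite -EFinB; congr EFin; field.
Qed.

Lemma integral_norm_sym (X : R) : (0 <= X)%R ->
  \int[mu]_(x in `[(- X)%R, X]) `|x|%:E = (X ^+ 2)%:E.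
Proof.
rewrite le_eqVlt => /predU1P[<-|X0].
  by rewrite oppr0 set_itv1 integral_set1 expr0n.
rewrite (@itv_bndbnd_setU _ _ _ (BRight 0%R))//=; last 2 first.
  by rewrite bnd_simp oppr_le0 ltW.
  by rewrite bnd_simp ltW.
have mn D : measurable_fun D (fun x : R => `|x|%:E).
  by apply/measurable_funTS/measurable_EFinP; exact: normr_measurable.
rewrite ge0_integral_setU//=; last 2 first.
  exact: mn.
  apply/disj_setPS => x [] /=.
  rewrite !in_itv /= => /andP[_ x0] /andP[/(le_lt_trans x0)].
  by rewrite ltxx.
rewrite [X in _ + X](_ : _ = \int[mu]_(x in `[0%R, X]) `|x|%:E); last first.
  exact: integral_itv_obnd_cbnd.
transitivity (\int[mu]_(x in `[(- X)%R, 0%R]) (-1 * x)%:E +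
              \int[mu]_(x in `[0%R, X]) (1 * x)%:E).
  congr (_ + _); apply: eq_integral => x; rewrite inE /= in_itv /= => /andP[].
    by move=> _ x0; rewrite mulN1r ler0_norm.
  by move=> x0 _; rewrite mul1r ger0_norm.
rewrite !integral_linear//; last by rewrite oppr_lt0.
by rewrite -EFinD; congr EFin; field.
Qed.

(** The radial integral of a sublevel set of a function that is homogeneous of
degree [n] and takes the value [v] at slope [t]; a direction in which the
function vanishes lies entirely in the set. *)
Lemma radial_integral (n : nat) (v : R) : (0 < n)%N -> (0 <= v)%R ->
  \int[mu]_x (`|x| * (`|x| ^+ n * v <= 1)%R%:R)%:E =
  if (v == 0)%R then +oo else (v `^ (- (2 / n%:R)))%:E.
Proof.
move=> n0 v0; have mn D : measurable_fun D (fun x : R => `|x|%:E).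
  by apply/measurable_funTS/measurable_EFinP; exact: normr_measurable.
case: ifPn => [/eqP ->|vn0].
  apply/eqyP => A A0.
  have A1 : (0 <= A + 1)%R by lra.
  apply: (@le_trans _ _ ((A + 1) ^+ 2)%:E); first by rewrite lee_fin; nra.
  rewrite -integral_norm_sym//.
  apply: (@le_trans _ _ (\int[mu]_x `|x|%:E)).
    by apply: ge0_subset_integral => //; exact: mn.
  rewrite le_eqVlt; apply/predU1P; left; apply: eq_integral => x _.
  by rewrite mulr0 ler01 mulr1.
have v_gt0 : (0 < v)%R by rewrite lt_neqAle eq_sym vn0.
have nR : (n%:R != 0 :> R)%R by rewrite pnatr_eq0 -lt0n.
pose X := (v `^ (- n%:R^-1))%R.
have X0 : (0 <= X)%R by exact: powR_ge0.
have Xn : (X ^+ n = v^-1)%R.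
  by rewrite -powR_mulrn// /X -powRrM mulNr mulVf// powRN powRr1.
have -> : (v `^ (- (2 / n%:R)) = X ^+ 2)%R.
  by rewrite -powR_mulrn// /X -powRrM mulNr mulrC.
rewrite -integral_norm_sym// [RHS]integral_mkcond.
apply: eq_integral => x _; rewrite patchE.
have -> : (x \in `[(- X)%R, X]%classic) = (`|x| ^+ n * v <= 1)%R.
  rewrite -ler_pdivlMr// div1r -Xn ler_pXn2r ?nnegrE//.
  by apply/idP/idP; rewrite inE /= in_itv /= -ler_norml.
by case: ifP => _; rewrite ?mulr1 ?mulr0.
Qed.

Lemma integral_oneDsqrV : \int[mu]_t ((1 + t ^+ 2)^-1)%:E = pi%:E.
Proof.
rewrite (ge0_symfun_integralT (f := fun t : R => (1 + t ^+ 2)^-1)%R).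
- by rewrite -set_itvcy integral0y_oneDsqr -EFinM; congr EFin; by field.
- by move=> x; rewrite invr_ge0 addr_ge0// sqr_ge0.
- exact: continuous_oneDsqrV.
- by move=> x; rewrite /= sqrrN.
Qed.

End plane_area.

(** * Values of a linear form on the unit circle *)

Section linear_forms.
Context (R : realType).
Local Open Scope complex_scope.
Implicit Types (p : R[i] * R[i]) (x y t : R).

Lemma normcM (z w : R[i]) : normc (z * w) = normc z * normc w.
Proof. exact: ComplexField.Normc.normcM. Qed.

Lemma normc_ge0 (z : R[i]) : 0 <= normc z.
Proof. by case: z => a b; rewrite sqrtr_ge0. Qed.

Lemma normcD (z w : R[i]) : normc (z + w) <= normc z + normc w.
Proof. exact: (@le_normcD R z w). Qed.

Lemma normc_sqr (z : R[i]) :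
  normc z ^+ 2 = complex.Re z ^+ 2 + complex.Im z ^+ 2.
Proof. by case: z => a b /=; rewrite sqr_sqrtr// addr_ge0// sqr_ge0. Qed.

Lemma normci : normc ('i : R[i]) = 1.
Proof. by rewrite /= expr0n expr1n add0r sqrtr1. Qed.

Lemma normc_half (z : R[i]) : normc (z / 2) = normc z / 2.
Proof.
rewrite normcM ComplexField.Normc.normcV; congr (_ / _).
by rewrite /= addr0 expr0n addr0 sqrtr_sqr ger0_norm.
Qed.

Definition lin_eval p x y : R[i] := p.2 * x%:C - p.1 * y%:C.

Lemma normc_lin_evalZ p (w x y : R) :
  normc (lin_eval p (w * x) (w * y)) = `|w| * normc (lin_eval p x y).
Proof.
rewrite (_ : lin_eval p (w * x) (w * y) = w%:C * lin_eval p x y).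
  by rewrite normcM /= expr0n addr0 sqrtr_sqr.
by rewrite /lin_eval !rmorphM; ring.
Qed.

(** The Fourier coefficients, of frequencies 1 and -1, of the restriction of the
linear form to the unit circle. *)
Definition fourier p : R[i] * R[i] :=
  ((p.2 + 'i * p.1) / 2, (p.2 - 'i * p.1) / 2).

Lemma lin_eval_fourier p t :
  lin_eval p (cos t) (sin t) =
  (fourier p).1 * (cos t +i* sin t) + (fourier p).2 * (cos t -i* sin t).
Proof.
have -> : cos t +i* sin t = (cos t)%:C + 'i * (sin t)%:C by simpc.
have -> : cos t -i* sin t = (cos t)%:C - 'i * (sin t)%:C by simpc.
rewrite /lin_eval /fourier /=; have i2 : 'i ^+ 2 = -1 :> R[i] by exact: sqr_i.
by field : i2.
Qed.

(** The geometric mean of the modulus of the form over the unit circle, by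
Jensen's formula. *)
Definition circle_mean p : R := Num.max (normc (fourier p).1) (normc (fourier p).2).

Lemma circle_mean_ge0 p : 0 <= circle_mean p.
Proof. by rewrite le_max normc_ge0. Qed.

Lemma normc_lin_eval_le p t :
  normc (lin_eval p (cos t) (sin t)) <= 2 * circle_mean p.
Proof.
have n1 (s : R) : s ^+ 2 = sin t ^+ 2 -> normc (cos t +i* s) = 1.
  by move=> /= ->; rewrite cos2Dsin2 sqrtr1.
rewrite lin_eval_fourier /circle_mean; move: (fourier p) => [u v] /=.
rewrite (le_trans (normcD _ _))// !normcM !n1 ?sqrrN//.
by rewrite !mulr1 mulr_natl mulr2n lerD// le_max lexx ?orbT.
Qed.

(** The linear form whose value at the angle [2 t] is the product of the values
of [p] at the angles [t] and [t + pi / 2]. *)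
Definition double_form p : R[i] * R[i] :=
  ((p.2 ^+ 2 - p.1 ^+ 2) / 2, - (p.2 * p.1)).

Lemma lin_eval_double p t :
  lin_eval p (cos t) (sin t)
    * lin_eval p (cos (t + pi / 2)) (sin (t + pi / 2))
  = lin_eval (double_form p) (cos (t *+ 2)) (sin (t *+ 2)).
Proof.
rewrite cosDpihalf sinDpihalf /lin_eval /double_form /= cos_mulr2n sin_mulr2n.
rewrite (_ : cos t ^+ 2 *+ 2 - 1 = cos t ^+ 2 - sin t ^+ 2); last first.
  by rewrite -(cos2Dsin2 t); ring.
by rewrite rmorphN rmorphB rmorphMn rmorphM !rmorphXn /=; field.
Qed.

Lemma fourier_double p :
  fourier (double_form p) =
  ('i * (fourier p).1 ^+ 2, - 'i * (fourier p).2 ^+ 2).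
Proof.
have i2 : 'i ^+ 2 = -1 :> R[i] by exact: sqr_i.
by rewrite /fourier /double_form /=; congr (_, _); field : i2.
Qed.

Lemma circle_mean_double p : circle_mean (double_form p) = circle_mean p ^+ 2.
Proof.
rewrite /circle_mean fourier_double; case: (fourier p) => u v.
rewrite [LHS]/= !expr2 !normcM.
rewrite (_ : normc (- 'i : R[i]) = 1) ?normci ?mul1r; last first.
  by rewrite /= oppr0 expr0n sqrrN expr1n add0r sqrtr1.
rewrite [RHS]/=; have [ab|/ltW ab] := leP (normc u) (normc v).
  by rewrite max_r// ler_pM// normc_ge0.
by rewrite max_l// ler_pM// normc_ge0.
Qed.

(** Up to the factor 2, which the [2 ^ m]-th root makes negligible, the
geometric mean over [2 ^ m] equally spaced directions is at most the one over
the circle.  The directions of indices [k] and [k + 2 ^ m] among [2 ^ m.+1] are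
orthogonal, so that their factors merge into a value of [double_form]. *)
Lemma prod_lin_eval_le p t m :
  \prod_(k < 2 ^ m) normc (lin_eval p (cos (t + k%:R * pi / 2 ^+ m))
                                      (sin (t + k%:R * pi / 2 ^+ m)))
  <= 2 * circle_mean p ^+ (2 ^ m).
Proof.
elim: m p t => [|m IH] p t.
  by rewrite expn0 big_ord1 expr1 mul0r mul0r addr0; exact: normc_lin_eval_le.
rewrite expnS exprM -circle_mean_double.
apply: le_trans (IH (double_form p) (t *+ 2)).
rewrite mul2n -addnn big_split_ord /= -big_split /=.
apply: ler_prod => k _; rewrite mulr_ge0 ?normc_ge0//= -normcM.
have h : (2 ^+ m : R) != 0 by rewrite expf_neq0.
rewrite (_ : t + (2 ^ m + k)%:R * pi / 2 ^+ m.+1 =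
             t + k%:R * pi / 2 ^+ m.+1 + pi / 2); last first.
  by rewrite natrD natrX exprS; field.
rewrite lin_eval_double (_ : _ *+ 2 = t *+ 2 + k%:R * pi / 2 ^+ m)//.
by rewrite exprS; field.
Qed.

Definition sqr_size p : R := normc p.1 ^+ 2 + normc p.2 ^+ 2.

Lemma fourier_parallelogram p :
  normc (fourier p).1 ^+ 2 + normc (fourier p).2 ^+ 2 = sqr_size p / 2.
Proof.
rewrite /sqr_size /fourier; case: p => -[a b] [c d]; rewrite [_.1]/= [_.2]/=.
by rewrite !normc_half !exprMn !normc_sqr /=; field.
Qed.

Lemma circle_mean_le p : circle_mean p ^+ 2 <= sqr_size p / 2.
Proof.
rewrite -fourier_parallelogram /circle_mean /Num.max; case: ifP => _.
  by rewrite lerDr sqr_ge0.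
by rewrite lerDl sqr_ge0.
Qed.

(** For a real root the form is a complex multiple of a real one, hence its two
Fourier coefficients have the same modulus and share the total equally. *)
Lemma circle_mean_real_le p : on_RP1 p -> circle_mean p ^+ 2 <= sqr_size p / 4.
Proof.
move=> [c [a [b [_ _ ->]]]].
have e (s : R) : s ^+ 2 = a ^+ 2 ->
    normc (c * b%:C + 'i * (c * s%:C)) ^+ 2 = normc c ^+ 2 * (a ^+ 2 + b ^+ 2).
  move=> sa; rewrite (_ : _ + _ = c * (b +i* s)); last first.
    rewrite (_ : b +i* s = b%:C + 'i * s%:C); last by simpc.
    by ring.
  by rewrite normcM exprMn [X in _ * X]normc_sqr /= sa addrC.
have e1 := e a erefl; have := e (- a) (sqrrN a).
rewrite rmorphN !mulrN => e2.
have -> : sqr_size (c * a%:C, c * b%:C) = normc c ^+ 2 * (a ^+ 2 + b ^+ 2).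
  by rewrite /sqr_size !normcM !exprMn !(normc_sqr (_%:C)) /=; ring.
rewrite /circle_mean /fourier /= !normc_half /Num.max; case: ifP => _.
  by rewrite exprMn e2 exprVn -natrX.
by rewrite exprMn e1 exprVn -natrX.
Qed.

Lemma circle_mean_gt0 p : p != (0, 0) -> 0 < circle_mean p.
Proof.
move=> p0; rewrite lt_neqAle circle_mean_ge0 andbT.
apply: contraNneq p0 => /esym pk.
have s0 : sqr_size p <= 0.
  have e1 : normc (fourier p).1 ^+ 2 = 0.
    apply/eqP; rewrite sqrf_eq0 eq_le normc_ge0 andbT.
    by rewrite -[X in _ <= X]pk le_max lexx.
  have e2 : normc (fourier p).2 ^+ 2 = 0.
    apply/eqP; rewrite sqrf_eq0 eq_le normc_ge0 andbT.
    by rewrite -[X in _ <= X]pk le_max lexx orbT.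
  by rewrite -[leRHS](mul0r 2) -ler_pdivrMr// -fourier_parallelogram e1 e2 addr0.
case: p {pk} s0 => a b; rewrite /sqr_size /= => s0.
have {}s0 : normc a ^+ 2 + normc b ^+ 2 == 0.
  by rewrite eq_le s0 addr_ge0// sqr_ge0.
move: s0; rewrite paddr_eq0 ?sqr_ge0// !sqrf_eq0 => /andP[/eqP a0 /eqP b0].
by rewrite (ComplexField.Normc.eq0_normc a0) (ComplexField.Normc.eq0_normc b0).
Qed.

(** Each linear factor costs a factor 2 against the square of the height, and
each factor with a real root costs a second one. *)
Lemma prod_circle_mean_le n (p : 'I_n -> R[i] * R[i]) :
  (\prod_j circle_mean (p j)) ^+ 2
    * 2 ^+ (n + #|[pred k | `[< on_RP1 (p k) >]]|)
  <= (\prod_j Num.sqrt (sqr_size (p j))) ^+ 2.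
Proof.
rewrite exprD mulrA -!prodrXl.
rewrite -[n in 2 ^+ n]card_ord -!prodr_const -big_split /=.
rewrite [X in _ * X]big_mkcond -big_split /=.
apply: ler_prod => j _.
rewrite !mulr_ge0 ?sqr_ge0 ?circle_mean_ge0//=; last by case: ifP.
rewrite sqr_sqrtr; last by rewrite addr_ge0 // sqr_ge0.
rewrite inE; case: asboolP => [/circle_mean_real_le|_]; last first.
  by rewrite mulr1 -ler_pdivlMr//; exact: circle_mean_le.
by rewrite -mulrA -natrM ler_pdivlMr.
Qed.

End linear_forms.

(** * An inequality between means that allows infinite terms *)

Section agm.
Context (R : realType).

Lemma powR_prod (I : Type) (s : seq I) (v : I -> R) (e : R) :
  (forall i, 0 <= v i) ->
  \prod_(i <- s) (v i `^ e) = (\prod_(i <- s) v i) `^ e.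
Proof.
move=> v0; elim: s => [|i s IH]; first by rewrite !big_nil powR1.
by rewrite !big_cons powRM ?IH// prodr_ge0.
Qed.

(** The value [+oo] given to a negative power of 0 is that of
[radial_integral]. *)
Lemma agm_inv (N : nat) (v : 'I_N -> R) (K e : R) : (0 < N)%N ->
  0 < K -> 0 <= e -> (forall k, 0 <= v k) -> \prod_k v k <= K ^+ N ->
  ((N%:R * K `^ (- e))%R%:E <=
   \sum_k if (v k == 0)%R then +oo else (v k `^ (- e))%R%:E)%E.
Proof.
move=> N0 K0 e0 v0 vK.
have [[k /eqP vk0]|nz] := pselect (exists k, v k = 0).
  rewrite (_ : (\sum_k _)%E = +oo%E) ?leey//; apply/esum_eqyP.
    by move=> i _; case: ifP.
  by exists k; split; rewrite ?mem_index_enum// vk0.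
have {}v0 k : 0 < v k.
  by rewrite lt_neqAle v0 andbT eq_sym; apply/eqP => vk; apply: nz; exists k.
under eq_bigr do rewrite gt_eqF//.
rewrite sumEFin lee_fin.
have [+ _] := @leif_AGM _ 'I_N predT (fun k => v k `^ (- e))
  (fun k _ => powR_ge0 _ _).
rewrite cardT size_enum_ord /= => agm.
have Np : 0 < N%:R :> R by rewrite ltr0n.
rewrite mulrC -ler_pdivlMr//.
rewrite -(@ler_pXn2r _ N)// ?nnegrE ?powR_ge0//; last first.
  by rewrite divr_ge0// ?sumr_ge0// => k _; exact: powR_ge0.
apply: le_trans agm.
rewrite powR_prod; last by move=> k; exact: ltW.
rewrite !powRN exprVn lef_pV2 ?posrE ?exprn_gt0 ?powR_gt0 ?prodr_gt0//.
rewrite -[leRHS]powR_mulrn ?powR_ge0// powRAC powR_mulrn ?(ltW K0)//.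
apply: ge0_ler_powR => //; rewrite nnegrE.
  by apply: prodr_ge0 => k _; exact: ltW.
by rewrite exprn_ge0// ltW.
Qed.

End agm.

(** * The area of a sublevel set of a product of linear forms *)

Section sublevel.
Context (R : realType).
Local Notation mu := (@lebesgue_measure R).
Local Notation mu2 := (mu \x mu)%E.
Local Open Scope classical_set_scope.
Implicit Types (n m : nat) (t : R).

Definition normc_prod n (p : 'I_n -> R[i] * R[i]) (z : R * R) : R :=
  \prod_j normc (lin_eval (p j) z.1 z.2).

Lemma measurable_normc_prod n (p : 'I_n -> R[i] * R[i]) :
  measurable_fun setT (normc_prod p).
Proof.
have -> : normc_prod p = (fun z => \prod_j Num.sqrt (
    (complex.Re (p j).2 * z.1 - complex.Re (p j).1 * z.2) ^+ 2 +
    (complex.Im (p j).2 * z.1 - complex.Im (p j).1 * z.2) ^+ 2)).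
  apply/funext => z; apply: eq_bigr => j _; rewrite /lin_eval.
  by case: (p j) => -[a b] [c d] /=; congr Num.sqrt; ring.
apply: measurable_prod => j _; apply: measurableT_comp.
  by apply: continuous_measurable_fun; exact: sqrt_continuous.
apply: measurable_funD; apply: measurable_funX; apply: measurable_funB;
 by apply: measurable_funM.
Qed.

Lemma measurable_sublevel n (p : 'I_n -> R[i] * R[i]) :
  measurable [set z | normc_prod p z <= 1].
Proof.
rewrite (_ : [set z | _] = setT `&` normc_prod p @^-1` `]-oo, 1]).
  exact: measurable_normc_prod.
by apply/seteqP; split => z /=; rewrite in_itv /= => // -[].
Qed.

(** The point [(x, x * t)] is [x * sqrt (1 + t^2)] times the unit vector of
angle [atan t], and homogeneity takes this scalar out. *)
Lemma normc_prod_rot n (p : 'I_n -> R[i] * R[i]) (a x t : R) :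
  normc_prod p (rot (cos a) (sin a) (x, x * t)) =
  `|x| ^+ n * (Num.sqrt (1 + t ^+ 2) ^+ n *
    \prod_j normc (lin_eval (p j) (cos (atan t + a)) (sin (atan t + a)))).
Proof.
set s := Num.sqrt _.
have s0 : s != 0 by rewrite sqrtr_eq0 -ltNge ltr_pwDl// sqr_ge0.
have ca : cos (atan t) = s^-1 by exact: cos_atan.
have sa : sin (atan t) = t / s.
  have c0 : cos (atan t) != 0 by rewrite ca invr_eq0.
  by rewrite -[t in RHS]atanK /tan -ca divfK.
have -> : rot (cos a) (sin a) (x, x * t) =
    (x * s * cos (atan t + a), x * s * sin (atan t + a)).
  rewrite /rot cosD sinD ca sa /=; congr (_, _); field; exact: s0.
rewrite mulrA -exprMn; set w := x * s.
rewrite (_ : `|x| * s = `|w|); last by rewrite normrM (ger0_norm (sqrtr_ge0 _)).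
rewrite -[n in _ ^+ n]card_ord -prodr_const -big_split /=.
by apply: eq_bigr => j _; rewrite /= normc_lin_evalZ.
Qed.

Lemma cos_neqN1 (a : R) : 0 <= a < pi -> cos a != -1.
Proof.
move=> /andP[a0 api]; rewrite -cospi; apply/eqP => /cos_inj api_eq.
suff ap : a = pi by rewrite ap ltxx in api.
by apply: api_eq; rewrite in_itv /= ?lexx ?pi_ge0 ?a0 ?(ltW api).
Qed.

(** The bound given by the [2 ^ m] rotations of angles [k * pi / 2 ^ m]: their
areas are equal, and for each slope the radial integrals are averaged by
[agm_inv]. *)
Lemma area_sublevel_ge_rot n (p : 'I_n -> R[i] * R[i]) m : (0 < n)%N ->
  (forall j, 0 < circle_mean (p j)) ->
  ((pi * (2 `^ (n%:R / 2 ^+ m) * \prod_j circle_mean (p j))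
           `^ (- (2 / n%:R)))%:E <=
   mu2 [set z | (normc_prod p z <= 1)%R])%E.
Proof.
move=> n0 p0; set D := [set z | _]; set B : R := _ * \prod_j _.
have mV : measurable_fun setT (fun t : R => (1 + t ^+ 2)^-1).
  by apply: continuous_measurable_fun; exact: continuous_oneDsqrV.
have mD : measurable D by exact: measurable_sublevel.
have nR : n%:R != 0 :> R by rewrite pnatr_eq0 -lt0n.
have B0 : 0 < B by rewrite mulr_gt0 ?powR_gt0//; apply: prodr_gt0 => j _.
have NR : 0 < (2 ^ m)%:R :> R by rewrite ltr0n expn_gt0.
pose a (k : 'I_(2 ^ m)) : R := k%:R * pi / 2 ^+ m.
pose E k := rot (cos (a k)) (sin (a k)) @^-1` D.
have mE k : measurable (E k) by exact: measurable_rot.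
have areaE k : mu2 (E k) = mu2 D.
  apply: area_rot => //; first exact: cos2Dsin2.
  apply: cos_neqN1; rewrite divr_ge0 ?mulr_ge0 ?pi_ge0 ?exprn_ge0//=.
  by rewrite ltr_pdivrMr ?exprn_gt0// mulrC ltr_pM2l ?pi_gt0// -natrX ltr_nat.
pose f k t := (\int[mu]_x (`|x| * \1_(E k) (x, x * t)%R)%:E)%E.
pose h t : R := Num.sqrt (1 + t ^+ 2).
have h0 t : 0 < h t by rewrite sqrtr_gt0 ltr_pwDl// sqr_ge0.
pose v k t := h t ^+ n *
  \prod_j normc (lin_eval (p j) (cos (atan t + a k)) (sin (atan t + a k))).
have v0 k t : 0 <= v k t.
  rewrite mulr_ge0 ?exprn_ge0 ?(ltW (h0 t))//.
  by apply: prodr_ge0 => j _; exact: normc_ge0.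
have fE k t : f k t =
    (if (v k t == 0)%R then +oo else (v k t `^ (- (2 / n%:R)))%R%:E)%E.
  rewrite -radial_integral//; apply: eq_integral => x _.
  rewrite indicE; congr (_ * (nat_of_bool _)%:R)%:E.
  by apply/idP/idP; rewrite inE /E /D /= normc_prod_rot.
have vle t : \prod_k v k t <= (h t ^+ n * B) ^+ (2 ^ m).
  rewrite big_split /= prodr_const card_ord exprMn.
  rewrite ler_pM2l ?exprn_gt0// exchange_big /=.
  have -> : B ^+ (2 ^ m) = \prod_j (2 * circle_mean (p j) ^+ (2 ^ m)).
    rewrite /B exprMn big_split /= prodrXl prodr_const card_ord; congr (_ * _).
    rewrite -[LHS]powR_mulrn ?powR_ge0// -powRrM natrX divfK ?expf_neq0//.
    by rewrite powR_mulrn.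
  apply: ler_prod => j _; rewrite prod_lin_eval_le andbT.
  by apply: prodr_ge0 => k _; exact: normc_ge0.
rewrite -(@lee_pmul2l _ (2 ^ m)%:R%:E)//.
have -> : ((2 ^ m)%:R%:E * mu2 D = \int[mu]_t \sum_k f k t)%E.
  rewrite ge0_integral_sum//.
  - under eq_bigr do rewrite -area_polar// areaE.
    by rewrite sumr_const card_ord mule_natl.
  - by move=> k; exact: measurable_radial_integral.
  - by move=> k t _; apply: integral_ge0 => x _; rewrite lee_fin mulr_ge0.
have -> : ((2 ^ m)%:R%:E * (pi * B `^ (- (2 / n%:R)))%:E =
    \int[mu]_t (((2 ^ m)%:R * B `^ (- (2 / n%:R)))%:E
                * ((1 + t ^+ 2)^-1)%:E))%E.
  rewrite ge0_integralZl_EFin//.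
  - by rewrite integral_oneDsqrV -!EFinM; congr EFin; ring.
  - by move=> t _; rewrite lee_fin invr_ge0 addr_ge0// sqr_ge0.
  - exact/measurable_EFinP.
  - by rewrite mulr_ge0// powR_ge0.
apply: ge0_le_integral => //.
- move=> t _; rewrite mule_ge0// lee_fin ?mulr_ge0 ?powR_ge0 ?invr_ge0//.
  by rewrite addr_ge0// sqr_ge0.
- apply/measurable_EFinP; apply: measurable_funM; last exact: mV.
  exact: measurable_cst.
- by apply: emeasurable_sum => k; exact: measurable_radial_integral.
move=> t _.
under eq_bigr do rewrite fE.
apply: le_trans (agm_inv _ _ _ _ (vle t)) => //.
- rewrite lee_fin -mulrA ler_pM2l// powRM ?exprn_ge0 ?(ltW (h0 t)) ?(ltW B0)//.
  rewrite mulrC -[h t ^+ n]powR_mulrn ?(ltW (h0 t))// -powRrM.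
  rewrite mulrN mulrCA divff// mulr1 [h t `^ _]powRN powR_mulrn ?(ltW (h0 t))//.
  by rewrite /h sqr_sqrtr ?lexx// addr_ge0// sqr_ge0.
- by rewrite expn_gt0.
- by rewrite mulr_gt0 ?exprn_gt0.
Qed.

(** The factor [2 `^ (n / 2 ^ m)] of the previous bound becomes
[2 `^ (- 2 / 2 ^ m)], which tends to 1 as [m] grows. *)
Lemma area_sublevel_ge n (p : 'I_n -> R[i] * R[i]) : (0 < n)%N ->
  (forall j, 0 < circle_mean (p j)) ->
  ((pi * (\prod_j circle_mean (p j)) `^ (- (2 / n%:R)))%:E <=
   mu2 [set z | (normc_prod p z <= 1)%R])%E.
Proof.
move=> n0 p0; have nR : n%:R != 0 :> R by rewrite pnatr_eq0 -lt0n.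
have M0 : 0 < \prod_j circle_mean (p j) by apply: prodr_gt0.
set C := pi * _.
have h m : ((C * expR (geometric (- 2 * ln 2) 2^-1 m))%:E <=
            mu2 [set z | (normc_prod p z <= 1)%R])%E.
  apply: le_trans (area_sublevel_ge_rot m n0 p0); rewrite lee_fin.
  rewrite powRM ?powR_ge0 ?(ltW M0)// -powRrM.
  have -> : n%:R / 2 ^+ m * - (2 / n%:R) = (- 2) * 2^-1 ^+ m :> R.
    by rewrite exprVn; field; rewrite nR expf_neq0.
  rewrite {1}/powR pnatr_eq0 /= le_eqVlt; apply/orP; left; apply/eqP.
  rewrite /geometric /=.
  rewrite (_ : - 2 * ln 2 * 2^-1 ^+ m = - 2 * 2^-1 ^+ m * ln 2); last by ring.
  by rewrite /C; ring.
move: h; case: (mu2 _) => [r h| _|h]; last first.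
- by have := h 0%N.
- exact: leey.
rewrite lee_fin.
have cvgC : C * expR (geometric (- 2 * ln 2) 2^-1 m) @[m --> \oo] --> C * expR 0.
  apply: cvgMl_tmp.
  apply: (@cvg_comp _ _ _ (geometric (- 2 * ln 2) 2^-1) expR).
    by apply: cvg_geometric; rewrite ger0_norm ?invr_ge0// invf_lt1// ltr1n.
  exact: continuous_expR.
rewrite -[C]mulr1 -expR0; apply: (cvgr_to_le cvgC).
by near=> m; rewrite -lee_fin.
Unshelve. all: by end_near.
Qed.

Lemma normc_form_eval n (F : mpoly 2%N R[i]) (p : {ffun 'I_n -> R[i] * R[i]})
    (z : R * R) :
  is_factorization F p -> normc (form_eval F z) = normc_prod p z.
Proof.
rewrite /is_factorization /form_eval => ->.
rewrite rmorph_prod /= (big_morph (@ComplexField.Normc.normc R) (@normcM R)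
  (ComplexField.Normc.normc1 R)).
apply: eq_bigr => j _; congr normc.
by rewrite /linear_form mevalB !mevalZ !mevalXU.
Qed.

End sublevel.

(** * The lower bound for the area of the fundamental region *)

Theorem theorem1p1 (R : realType) (n r : nat) (F : mpoly 2%N R[i])
    (n_ge1 : (1 <= n)%N) (F_form : binary_form n F) (F_neq0 : F != 0)
    (F_roots : num_real_roots n F = r) :
  ((2 `^ (1 + r%:R / n%:R) * pi)%:E
     <= (height n F `^ (2 / n%:R))%:E * area (fundamental_region F))%E.
Proof.
have [p Fp] := factorization_exists n_ge1 F_form.
have nR : n%:R != 0 :> R by rewrite pnatr_eq0 -lt0n.
have p0 j : 0 < circle_mean (p j).
  apply: circle_mean_gt0; apply: contraNneq F_neq0 => pj.
  by rewrite Fp (bigD1 j)//= pj /linear_form !scale0r subrr mul0r.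
set M := \prod_j circle_mean (p j).
have M0 : 0 < M by apply: prodr_gt0 => j _.
have hE : height n F = \prod_j Num.sqrt (sqr_size (p j)) by exact: heightE.
have h0 : 0 < height n F.
  rewrite hE; apply: prodr_gt0 => j _; rewrite sqrtr_gt0.
  rewrite -[ltLHS](mul0r 2) -ltr_pdivlMr//.
  by rewrite (lt_le_trans _ (circle_mean_le _))// exprn_gt0.
have Mh : M ^+ 2 * 2 ^+ (n + r) <= height n F ^+ 2.
  rewrite hE -F_roots (num_real_rootsE F_neq0 Fp).
  exact: prod_circle_mean_le.
have -> : fundamental_region F = [set z | normc_prod p z <= 1]%classic.
  apply/seteqP.
  by split => z; rewrite /fundamental_region /= (normc_form_eval _ Fp).
apply: le_trans (lee_pmul _ _ (lexx _) (area_sublevel_ge n_ge1 p0)); last 2 first.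
- by rewrite lee_fin powR_ge0.
- by rewrite lee_fin mulr_ge0 ?pi_ge0 ?powR_ge0.
(* It remains to raise [Mh] to the power [1 / n]. *)
rewrite -EFinM lee_fin -/M mulrCA [leLHS]mulrC ler_pM2l ?pi_gt0//.
rewrite powRN ler_pdivlMr ?powR_gt0// mulrC.
have e (x : R) : 0 <= x -> x `^ (2 / n%:R) = (x ^+ 2) `^ n%:R^-1.
  by move=> x0; rewrite powRrM powR_mulrn.
rewrite !e ?(ltW M0) ?(ltW h0)//.
have -> : 2 `^ (1 + r%:R / n%:R) = (2 ^+ (n + r)) `^ n%:R^-1 :> R.
  by rewrite -powR_mulrn// -powRrM natrD mulrDl divff.
rewrite -powRM ?exprn_ge0 ?(ltW M0)//.
apply: ge0_ler_powR => //;
  by rewrite ?nnegrE ?invr_ge0 ?mulr_ge0 ?exprn_ge0 ?(ltW M0) ?(ltW h0).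
Qed.
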